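(* Let $m \in \mathbb{N}=\{0,1,2,\dots\}$ and let $k$ be a positive integer. Then $$D_{2k,1-k-m,t}(N) = 0 \quad \text{for } N = 1, 2, \ldots, m+k-1,$$ and for all $n \in \mathbb{N}$ $$D_{2k,1-k-m,t}(n+m+k) = (-1)^{\binom{m+k}{2}}\, t^{kn}\, D_{2k,1-k+m,t}(n).$$
   Context: Here $t$ is an indeterminate and all identities are identities of polynomials in $t$. The Narayana polynomials are $C_0(t)=1$ and $C_n(t) = \sum_{j=0}^{n-1} \binom{n}{j}\binom{n-1}{j}\frac{1}{j+1} t^j$ for $n>0$. Define the formal power series in $x$ $$c_0(x,t) = \sum_{n\ge 0} C_n(t) x^n, \qquad c_1(x,t) = 1 + t\sum_{n\ge 1} C_n(t) x^n .$$ Define $c(x,t)^{(k)}$ for integers $k \ge 0$ by $c(x,t)^{(0)}=1$, $c(x,t)^{(2k+1)} = c(x,t)^{(2k)} c_0(x,t)$ for $k\ge 0$, and $c(x,t)^{(2k)} = c(x,t)^{(2k-1)} c_1(x,t)$ for $k \ge 1$ (so $c(x,t)^{(2k)} = c_0(x,t)^k c_1(x,t)^k$ and $c(x,t)^{(2k+1)} = c_0(x,t)^{k+1}c_1(x,t)^k$). Let $C_{k,n}(t) = [x^n]\, c(x,t)^{(k)}$ be the coefficient of $x^n$ for $n \ge 0$, and $C_{k,n}(t)=0$ for $n<0$. For $M\in\mathbb{Z}$ and integers $K,N\ge 1$ define $$D_{K,M,t}(N) = \det\left(C_{K,i+j+M}(t)\right)_{i,j=0}^{N-1},$$ and set $D_{K,M,t}(0)=1$.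 *)

(* Defs.v *)
From HB Require Import structures.
From mathcomp Require Import all_boot all_order all_algebra.

Set Implicit Arguments.
Unset Strict Implicit.
Unset Printing Implicit Defensive.

Import GRing.Theory.
Local Open Scope ring_scope.

(* The formal power series \sum_n (f n) x^n is represented by its coefficient
   sequence f; here [x^n] is evaluation at n. *)
Definition fps (R : Type) : Type := nat -> R.

Definition fps_one (R : pzRingType) : fps R := fun n => (n == 0%N)%:R.

Definition fps_mul (R : pzRingType) (f g : fps R) : fps R :=
  fun n => \sum_(i < n.+1) f i * g (n - i)%N.

(* The indeterminate t is 'X in {poly rat}. *)
Definition narayana (n : nat) : {poly rat} :=
  if n == 0%N then 1
  else \sum_(0 <= j < n)
         ('C(n, j)%:R * 'C(n.-1, j)%:R * (j.+1%:R)^-1 : rat) *: 'X^j.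

Definition c0 : fps {poly rat} := fun n => narayana n.

Definition c1 : fps {poly rat} :=
  fun n => if n == 0%N then 1 else 'X * narayana n.

(* Step k -> k+1 multiplies by c0 when k is even and by c1 when k is odd. *)
Fixpoint cpow (k : nat) : fps {poly rat} :=
  match k with
  | 0 => fps_one {poly rat}
  | k'.+1 => fps_mul (cpow k') (if odd k' then c1 else c0)
  end.

(* Negz p stands for the integer -(p+1). *)
Definition Ccoef (k : nat) (n : int) : {poly rat} :=
  match n with
  | Posz p => cpow k p
  | Negz _ => 0
  end.

(* For N = 0 this is the determinant of the empty matrix, which is 1
   (det_mx00). *)
Definition hankelD (K : nat) (M : int) (N : nat) : {poly rat} :=
  \det (\matrix_(i < N, j < N) Ccoef K (i%:Z + j%:Z + M)).

(* Main.v *)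
Require Import Defs.
From HB Require Import structures.
From mathcomp Require Import all_boot all_order all_algebra.
From mathcomp Require Import boolp ring zify.
Import GRing.Theory Num.Theory.
Set Implicit Arguments.
Unset Strict Implicit.
Unset Printing Implicit Defensive.
Local Open Scope ring_scope.

(** Put u = c0 c1, so that the series c^(2k) of the statement is u ^ k, and
    p = m + k.  The left-hand determinant is the Hankel determinant of the
    coefficients of x ^ (p - 1) u ^ k.

    If N < p, the first row of that Hankel matrix consists of coefficients of
    degree less than p - 1, which vanish.

    For N = p + n, multiply the Hankel matrix on the left by the unipotent lower
    triangular Toeplitz matrix of the reciprocal series u ^ (- k).  The product
    is block upper triangular: an antidiagonal block of size p, responsible
    for the sign (-1) ^ C(p, 2), and a block which is, up to a unipotent factor,
    the opposite of the Hankel matrix of the coefficients of u ^ (- k) starting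
    at index p + 1 ([det_hankel_inv]).

    It remains to compare u ^ (- k) with u ^ k.  The Narayana polynomials satisfy
    c0 = 1 + x c0 c1 ([narayana_functional]), hence u is a root of
    t x^2 u^2 - (1 - (1 + t) x) u + 1 = 0.  So 1 / u and t x^2 u are two
    quantities with polynomial sum 1 - (1 + t) x and polynomial product t x^2,
    and the sum of their k-th powers is a polynomial in x of degree at most k
    ([cprod_pow_trace_coef]).  Beyond degree k the coefficients of u ^ (- k) are
    therefore those of - t^k x^(2k) u^k.  The index shift 2k turns p + 1 into
    1 - k + m, and the n factors - t^k cancel the remaining sign (-1) ^ n and
    leave t ^ (k n).

    The functional equation is derived from the closed formula for the Narayana
    numbers.  Solving the quadratic equation for c0 would give
    w := 1 - (1 - t) x - 2 t x c0 as the square root of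
    Delta := (1 - (1 - t) x)^2 - 4 t x.  The three-term recurrence of the Narayana
    polynomials ([narayana_rec]), which is checked on coefficients, amounts with the
    first values to Delta w' = (Delta' / 2) w ([sqrt_discr_ode]); so w^2 and Delta solve the same
    first-order linear equation with the same initial value, and w^2 = Delta
    expands to the functional equation. *)

(** * The commutative ring of formal power series *)

Lemma fps_ext (R : Type) (f g : fps R) : (forall n, f n = g n) -> f = g.
Proof. by move=> fg; apply: functional_extensionality_dep. Qed.

HB.instance Definition _ (R : Type) := gen_eqMixin (fps R).
HB.instance Definition _ (R : Type) := gen_choiceMixin (fps R).

Section SeriesRing.
Variable R : comNzRingType.
Implicit Types (f g h : fps R) (p q : {poly R}).

Let fps_add f g : fps R := fun n => f n + g n.
Let fps_opp f : fps R := fun n => - f n.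
Let fps_zero : fps R := fun=> 0.

Fact fps_addA : associative fps_add.
Proof. by move=> f g h; apply: fps_ext => n; apply: addrA. Qed.
Fact fps_addC : commutative fps_add.
Proof. by move=> f g; apply: fps_ext => n; apply: addrC. Qed.
Fact fps_add0 : left_id fps_zero fps_add.
Proof. by move=> f; apply: fps_ext => n; apply: add0r. Qed.
Fact fps_addN : left_inverse fps_zero fps_opp fps_add.
Proof. by move=> f; apply: fps_ext => n; apply: addNr. Qed.

HB.instance Definition _ :=
  GRing.isZmodule.Build (fps R) fps_addA fps_addC fps_add0 fps_addN.

(** Ring identities for series are transported from polynomials: a coefficient of
    a product depends only on finitely many coefficients of the factors, so
    series may be replaced by truncations of high enough order. *)
Lemma eq_coefM (p p' q q' : {poly R}) n :
    (forall i, (i <= n)%N -> p`_i = p'`_i) ->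
    (forall i, (i <= n)%N -> q`_i = q'`_i) ->
  (p * q)`_n = (p' * q')`_n.
Proof.
move=> pp' qq'; rewrite !coefM; apply: eq_bigr => -[i /= lt_in] _.
by rewrite pp' // qq' // leq_subr.
Qed.

Definition truncate N f : {poly R} := \poly_(i < N) f i.

Lemma coef_truncate N f i : (i < N)%N -> (truncate N f)`_i = f i.
Proof. by rewrite coef_poly => ->. Qed.

Lemma coef_fps_mul N f g n :
  (n < N)%N -> fps_mul f g n = (truncate N f * truncate N g)`_n.
Proof.
move=> lt_nN; rewrite coefM; apply: eq_bigr => -[i /= lt_in] _.
by rewrite !coef_truncate //; apply: leq_trans lt_nN; rewrite ltnS ?leq_subr.
Qed.

Fact fps_mulA : associative (@fps_mul R).
Proof.
move=> f g h; apply: fps_ext => n.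
have lt_n i : (i <= n)%N -> (i < n.+1)%N by [].
rewrite (@coef_fps_mul n.+1) // (@coef_fps_mul n.+1) //.
transitivity ((truncate n.+1 f * (truncate n.+1 g * truncate n.+1 h))`_n).
  by apply: eq_coefM => [|i /lt_n ?] //; rewrite coef_truncate // (@coef_fps_mul n.+1).
rewrite mulrA; apply: eq_coefM => [i /lt_n ?|] //.
by rewrite coef_truncate // (@coef_fps_mul n.+1).
Qed.

Fact fps_mulC : commutative (@fps_mul R).
Proof.
by move=> f g; apply: fps_ext => n; rewrite !(@coef_fps_mul n.+1) // mulrC.
Qed.

Fact fps_mul1 : left_id (fps_one R) (@fps_mul R).
Proof.
move=> f; apply: fps_ext => n; rewrite /fps_mul big_ord_recl mul1r subn0.
by rewrite big1 ?addr0 // => i _; rewrite mul0r.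
Qed.

Fact fps_mulDl : left_distributive (@fps_mul R) fps_add.
Proof.
move=> f g h; apply: fps_ext => n; rewrite /fps_add /fps_mul -big_split /=.
by apply: eq_bigr => i _; rewrite mulrDl.
Qed.

Fact fps_one_neq0 : fps_one R != (0 : fps R).
Proof.
apply/eqP => /(congr1 (fun f : fps R => f 0%N)) /eqP.
by rewrite [_ == _]oner_eq0.
Qed.

HB.instance Definition _ := GRing.Zmodule_isComNzRing.Build (fps R)
  fps_mulA fps_mulC fps_mul1 fps_mulDl fps_one_neq0.

Definition fpsC (a : R) : fps R := fun n => if n is 0 then a else 0.
Definition fpsX : fps R := fun n => (n == 1%N)%:R.
Definition fps_deriv f : fps R := fun n => f n.+1 *+ n.+1.

Lemma fpsD f g n : (f + g) n = f n + g n. Proof. by []. Qed.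
Lemma fpsN f n : (- f) n = - f n. Proof. by []. Qed.
Lemma fpsB f g n : (f - g) n = f n - g n. Proof. by []. Qed.
Lemma fps0 n : (0 : fps R) n = 0. Proof. by []. Qed.
Lemma fps1 n : (1 : fps R) n = (n == 0%N)%:R. Proof. by []. Qed.
Lemma fpsM f g n : (f * g) n = \sum_(i < n.+1) f i * g (n - i)%N.
Proof. by []. Qed.

Lemma fpsMn f k n : (f *+ k) n = f n *+ k.
Proof. by elim: k => [|k IHk] //; rewrite !mulrS fpsD IHk. Qed.

Lemma fpsCM a f n : (fpsC a * f) n = a * f n.
Proof.
rewrite fpsM big_ord_recl subn0 big1 ?addr0 // => i _.
by rewrite /= mul0r.
Qed.

Lemma fpsXM f n : (fpsX * f) n = if n is n'.+1 then f n' else 0.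
Proof.
rewrite fpsM; case: n => [|n]; rewrite big_ord_recl mul0r add0r ?big_ord0 //.
rewrite big_ord_recl /= mul1r subSS subn0 big1 ?addr0 // => i _.
by rewrite /= mul0r.
Qed.

Lemma fpsXnM k f n : (fpsX ^+ k * f) n = if (n < k)%N then 0 else f (n - k)%N.
Proof.
elim: k n => [|k IHk] n; first by rewrite mul1r subn0.
by rewrite exprS -mulrA fpsXM; case: n => // n; rewrite IHk ltnS subSS.
Qed.

Lemma fpsC_exp a k : fpsC a ^+ k = fpsC (a ^+ k).
Proof.
elim: k => [|k IHk]; first by apply: fps_ext; case.
rewrite !exprS IHk; apply: fps_ext => n; rewrite fpsCM.
by case: n => //= n; rewrite mulr0.
Qed.

Lemma fps_derivD f g : fps_deriv (f + g) = fps_deriv f + fps_deriv g.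
Proof. by apply: fps_ext => n; rewrite /fps_deriv !fpsD mulrnDl. Qed.

Lemma fps_derivN f : fps_deriv (- f) = - fps_deriv f.
Proof. by apply: fps_ext => n; rewrite /fps_deriv !fpsN mulNrn. Qed.

Lemma fps_derivM f g : fps_deriv (f * g) = fps_deriv f * g + f * fps_deriv g.
Proof.
apply: fps_ext => n; rewrite /fps_deriv fpsD.
have mulE h k i : (i < n.+2)%N ->
    (h * k) i = (truncate n.+2 h * truncate n.+2 k)`_i by exact: coef_fps_mul.
rewrite !mulE // -coef_deriv derivM coefD.
by congr (_ + _); apply: eq_coefM => i le_in //;
  rewrite coef_deriv !coef_truncate // ltnS ltnW.
Qed.

End SeriesRing.

(** * Hankel determinants of a series and of its reciprocal *)
Section Hankel.
Variable R : comNzRingType.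

(** Expansion along the first row, whose only nonzero entry is the last one:
    each step contributes the sign (-1) ^ p, and C(p+1, 2) = C(p, 2) + p. *)
Lemma det_antidiag p :
  \det (\matrix_(i < p, j < p) ((i + j).+1 == p)%:R : 'M[R]_p) = (-1) ^+ 'C(p, 2).
Proof.
elim: p => [|p IHp]; first by rewrite det_mx00 expr0.
rewrite (expand_det_row _ ord0) (bigD1 ord_max) //= big1 ?addr0; last first.
  move=> j ne_j; rewrite mxE /= add0n eqSS.
  by have /negPf-> : val j != p by []; rewrite mul0r.
rewrite mxE /= add0n eqxx mul1r /cofactor add0n binS bin1 exprD mulrC.
rewrite -IHp; congr (\det _ * _); apply/matrixP => i j.
by rewrite !mxE /= /bump /= add1n leqNgt ltn_ord add0n addSn eqSS.
Qed.

Definition fps_drop k (f : fps R) : fps R := fun n => f (k + n)%N.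

(** The sum on the right is the part of the convolution computing the coefficient of
    degree i + b + 1 in f g that involves the first b + 1 coefficients of f; the
    whole convolution vanishes because f g = 1. *)
Lemma fps_mul_drop_inv (f g : fps R) b i :
    f * g = 1 ->
  (g * fps_drop b.+1 f) i = - \sum_(c < b.+1) g (i + b.+1 - c)%N * f c.
Proof.
move=> fg1; apply/eqP; rewrite -addr_eq0 addrC mulrC fpsM; apply/eqP.
transitivity ((f * g) (i + b.+1)%N); last by rewrite fg1 fps1 addnS.
rewrite fpsM (_ : (i + b.+1).+1 = b.+1 + i.+1)%N; last by rewrite addnC addnS.
rewrite big_split_ord /=; congr (_ + _).
  by apply: eq_bigr => c _; rewrite mulrC.
by apply: eq_bigr => l _; rewrite [(i + _)%N]addnC subnDl.
Qed.

Lemma fps_dropXn q j (f : fps R) :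
  (j <= q)%N -> fps_drop j (fpsX R ^+ q * f) = fpsX R ^+ (q - j) * f.
Proof.
move=> le_jq; apply: fps_ext => n; rewrite /fps_drop !fpsXnM ltn_subRL.
by case: ltnP => // _; rewrite subnBA // addnC.
Qed.

Lemma fps_dropXnS q b (f : fps R) :
  fps_drop (q + b) (fpsX R ^+ q * f) = fps_drop b f.
Proof.
apply: fps_ext => n; rewrite /fps_drop fpsXnM -addnA ltnNge leq_addr /=.
by rewrite addKn.
Qed.

(** Column j of a Hankel matrix lists the coefficients of F without its first j
    terms, and a lower triangular Toeplitz matrix acts on coefficient columns as
    multiplication by a series. *)
Lemma toeplitz_mul_hankel N (g F : fps R) (i j : 'I_N) :
  ((\matrix_(i < N, l < N) (if (l <= i)%N then g (i - l)%N else 0)) *m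
   (\matrix_(l < N, j < N) F (l + j)%N)) i j = (g * fps_drop j F) i.
Proof.
rewrite mxE mulrC fpsM (big_ord_widen N (fun l => fps_drop j F l * g (i - l)%N)) //.
rewrite [RHS]big_mkcond; apply: eq_bigr => l _; rewrite !mxE ltnS.
by case: ifP; rewrite ?mul0r // mulrC /fps_drop addnC.
Qed.

Lemma det_unit_toeplitz N (g : fps R) :
  g 0%N = 1 -> \det (\matrix_(i < N, l < N) (if (l <= i)%N then g (i - l)%N else 0)) = 1.
Proof.
move=> g0; rewrite det_trig => [|]; last first.
  by apply/is_trig_mxP => i j lt_ij; rewrite mxE leqNgt lt_ij.
by rewrite big1 // => i _; rewrite mxE leqnn subnn.
Qed.

(** Multiplying the Hankel matrix by the Toeplitz matrix of g amounts to
    multiplying each column series by g.  The first q + 1 columns are the series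
    x ^ (q - j) f, which become monomials; in the others, [fps_mul_drop_inv]
    produces a Hankel matrix of g times a triangular Toeplitz matrix of f. *)
Lemma det_hankel_inv q n (f g : fps R) :
    f * g = 1 -> f 0%N = 1 -> g 0%N = 1 ->
  \det (\matrix_(i < q.+1 + n, j < q.+1 + n) (fpsX R ^+ q * f) (i + j)%N) =
  (-1) ^+ 'C(q.+1, 2) * (-1) ^+ n * \det (\matrix_(i < n, j < n) g (i + j + q.+2)%N).
Proof.
move=> fg1 f0 g0; set H := \matrix_(i, j) _; set G := \matrix_(i, j) g _.
pose L : 'M[R]_(q.+1 + n) := \matrix_(i, l) (if (l <= i)%N then g (i - l)%N else 0).
pose U : 'M[R]_n := (\matrix_(i, l) (if (l <= i)%N then f (i - l)%N else 0))^T.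
have LHE i j : (L *m H) i j = (g * fps_drop j (fpsX R ^+ q * f)) i.
  exact: toeplitz_mul_hankel.
have ul : ulsubmx (L *m H) = \matrix_(i, j) ((i + j).+1 == q.+1)%:R.
  apply/matrixP => i j; rewrite [LHS]mxE [LHS]mxE LHE [RHS]mxE /= fps_dropXn ?leq_ord //.
  rewrite mulrCA [g * f]mulrC fg1 fpsXnM fps1 eqSS.
  have le_jq := leq_ord j.
  by case: ltnP => lt_i; [rewrite ltn_eqF // | congr ((nat_of_bool _)%:R)]; lia.
have dl : dlsubmx (L *m H) = 0.
  apply/matrixP => i j; rewrite [LHS]mxE [LHS]mxE LHE [RHS]mxE /= fps_dropXn ?leq_ord //.
  rewrite mulrCA [g * f]mulrC fg1 fpsXnM fps1.
  case: ltnP => // _; rewrite subn_eq0.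
  by rewrite leqNgt (leq_ltn_trans (leq_subr _ _)) // leq_addr.
have dr : drsubmx (L *m H) = - (G *m U).
  apply/matrixP => i j; rewrite [LHS]mxE [LHS]mxE LHE [RHS]mxE /= addSnnS fps_dropXnS.
  rewrite fps_mul_drop_inv // mxE; congr (- _).
  (* The sum over c <= j becomes a full matrix product entry: reversing it
     matches the Toeplitz entries f (j - c), which are 0 beyond c = j. *)
  rewrite (reindex_inj rev_ord_inj) /=.
  rewrite (big_ord_widen n (fun c => g (q.+1 + i + j.+1 - (j - c))%N * f (j - c)%N)) //.
  rewrite big_mkcond; apply: eq_bigr => c _; rewrite !mxE ltnS.
  case: ifP => le_cj; last by rewrite mulr0.
  by congr (g _ * _); lia.
have detL : \det L = 1 by apply: det_unit_toeplitz.
have detU : \det U = 1 by rewrite det_tr; apply: det_unit_toeplitz.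
have <- : \det (L *m H) = \det H by rewrite det_mulmx detL mul1r.
rewrite -[L *m H]submxK dl det_ublock ul dr.
by rewrite det_antidiag -scaleN1r detZ det_mulmx detU mulr1 mulrA.
Qed.
End Hankel.

(** * The functional equation of the Narayana series *)
Section Narayana.

(** The formula also covers n = 0, and j >= n where the binomials vanish; this
    spares boundary cases in the recurrence below. *)
Lemma coef_narayana n j :
  (narayana n)`_j = 'C(n, j)%:R * 'C(n.-1, j)%:R * j.+1%:R^-1.
Proof.
rewrite /narayana; case: n => [|n] /=.
  by rewrite coef1 !bin0n; case: j => [|j]; rewrite ?mul0r.
rewrite big_mkord -(poly_def _ (fun j => 'C(n.+1, j)%:R * 'C(n, j)%:R / j.+1%:R)).
rewrite coef_poly; case: ltnP => // lt_nj.
by rewrite (bin_small lt_nj) mulr0 mul0r.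
Qed.

(** The subtraction takes place in the rationals, which makes this valid for all
    n and i: when n < i both binomials vanish, and when n = i the factor does. *)
Lemma binS_rat n i : ('C(n, i.+1)%:R : rat) = (n%:R - i%:R) / i.+1%:R * 'C(n, i)%:R.
Proof.
have := mul_bin_left n i; case: (leqP i n) => [le_in|lt_ni _]; last first.
  by rewrite !bin_small ?mulr0 // ltnW.
move/(congr1 (fun k => k%:R : rat)); rewrite !natrM natrB // => eq_bin.
by rewrite mulrAC -eq_bin mulrC mulKf // pnatr_eq0.
Qed.

Lemma binSS_rat n i : ('C(n.+1, i.+1)%:R : rat) = n.+1%:R / i.+1%:R * 'C(n, i)%:R.
Proof.
have /(congr1 (fun k => k%:R : rat)) := mul_bin_diag n.+1 i; rewrite !natrM => eq_bin.
by rewrite mulrAC eq_bin mulrC mulKf // pnatr_eq0.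
Qed.

(** Together with [narayana_coefSS], this expresses every coefficient occurring in
    the recurrence as a rational multiple of a single one, with denominators that
    never vanish. *)
Lemma narayana_coefS n i :
  (narayana n.+1)`_i.+1 =
  (n.+1%:R - i%:R) * (n%:R - i%:R) / (i.+1%:R * i.+2%:R) * (narayana n.+1)`_i.
Proof.
have nz k : (k.+1%:R : rat) != 0 by rewrite pnatr_eq0.
have nz0 := nz i; have nz1 := nz i.+1.
move: nz0 nz1; rewrite !coef_narayana /= !binS_rat -!natr1 => nz0 nz1.
by field; rewrite nz0 nz1.
Qed.

Lemma narayana_coefSS n i :
  (narayana n.+2)`_i.+1 =
  n.+2%:R * n.+1%:R / (i.+1%:R * i.+2%:R) * (narayana n.+1)`_i.
Proof.
have nz k : (k.+1%:R : rat) != 0 by rewrite pnatr_eq0.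
have nz0 := nz i; have nz1 := nz i.+1.
move: nz0 nz1; rewrite !coef_narayana /= !binSS_rat -!natr1 => nz0 nz1.
by field; rewrite nz0 nz1.
Qed.

(** With N = n + 3 this is the classical recurrence
    (N + 1) C_N = (2 N - 1) (1 + t) C_(N-1) - (N - 2) (1 - t)^2 C_(N-2).
    The coefficients of degree 0 and 1 are treated separately because the factors
    1 + t and (1 - t)^2 shift degrees by up to 2. *)
Lemma narayana_rec n :
  n.+4%:R *: narayana n.+3 = (n.+2 + n.+3)%:R *: ((1 + 'X) * narayana n.+2)
     - n.+1%:R *: ((1 - 'X) ^+ 2 * narayana n.+1).
Proof.
have -> : (1 - 'X) ^+ 2 * narayana n.+1 = narayana n.+1 - ('X * narayana n.+1) *+ 2
    + 'X * ('X * narayana n.+1) by ring.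
rewrite mulrDl mul1r; apply/polyP => j.
rewrite !(coefB, coefD, coefZ, coefMn, coefXM) natrD.
case: j => [|[|i]] /=.
- by rewrite !coef_narayana !bin0 -!natr1; ring.
- by rewrite !coef_narayana !bin0 !bin1 -!natr1; field.
have nz k : (k.+1%:R : rat) != 0 by rewrite pnatr_eq0.
rewrite !(narayana_coefSS, narayana_coefS).
have nz0 := nz i; have nz1 := nz i.+1; have nz2 := nz i.+2.
move: nz0 nz1 nz2; rewrite -!natr1 => nz0 nz1 nz2.
by field; rewrite nz0 nz1 nz2.
Qed.

Local Notation T := (fpsC ('X : {poly rat})).
Local Notation x := (fpsX {poly rat}).

Lemma poly_rat_mulrn_eq0 (p : {poly rat}) n : p *+ n.+1 = 0 -> p = 0.
Proof. by move/eqP; rewrite -scaler_nat scaler_eq0 pnatr_eq0 => /eqP. Qed.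

(** In characteristic 0, the equation determines the coefficient n + 1 of h from
    the previous ones, since D is invertible. *)
Lemma fps_lin_ode_unique (D D' h : fps {poly rat}) :
  D 0%N = 1 -> D * fps_deriv h = D' * h -> h 0%N = 0 -> h = 0.
Proof.
move=> D0 ode h0; apply: fps_ext => n; rewrite fps0.
elim/ltn_ind: n => -[//|n] IHn; apply: (@poly_rat_mulrn_eq0 _ n).
have := congr1 (fun f : fps {poly rat} => f n) ode; rewrite /= mulrC [D' * h]mulrC !fpsM.
rewrite [RHS]big1 => [|i _]; last by rewrite IHn ?mul0r.
rewrite big_ord_recr /= subnn D0 mulr1 big1 ?add0r // => i _.
by rewrite /fps_deriv IHn ?mul0rn ?mul0r // ltnS.
Qed.

(** The discriminant of the quadratic equation
    x t y^2 - (1 - x (1 - t)) y + 1 = 0 expected of c0, half its derivative, and the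
    square root of it which corresponds to the root c0. *)
Definition discr : fps {poly rat} := 1 - (1 + T) * x *+ 2 + ((1 - T) * x) ^+ 2.
Definition half_discr_deriv : fps {poly rat} := (1 - T) ^+ 2 * x - (1 + T).
Definition sqrt_discr : fps {poly rat} := 1 - x * (1 - T) - x * (T * c0) *+ 2.

Lemma c1E : c1 = 1 + T * (c0 - 1).
Proof.
apply: fps_ext => n; rewrite fpsD fpsCM fpsB fps1 /c1 /c0.
by case: n => [|n]; rewrite /= /narayana /= ?subrr ?mulr0 ?addr0 // subr0 add0r.
Qed.

Lemma narayana0 : narayana 0 = 1. Proof. by []. Qed.

Lemma narayana1 : narayana 1 = 1.
Proof.
apply/polyP => j; rewrite coef_narayana coef1 bin0n.
by case: j => [|j]; rewrite ?bin0 ?mulr0 ?mul0r // mulr1 divr1.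
Qed.

Lemma narayana2 : narayana 2 = 1 + 'X.
Proof.
apply/polyP => j; rewrite coef_narayana coefD coef1 coefX.
case: j => [|[|[|j]]] //=; rewrite ?bin0 ?bin1 ?bin_small ?mul0r //.
Qed.

Lemma oneD_fpsC (a : {poly rat}) : 1 + fpsC a = fpsC (1 + a).
Proof. by apply: fps_ext => -[|n]; rewrite fpsD fps1 /= ?addr0. Qed.

Lemma oneB_fpsC (a : {poly rat}) : 1 - fpsC a = fpsC (1 - a).
Proof. by apply: fps_ext => -[|n]; rewrite fpsB fps1 /= ?subr0. Qed.

(** The next two forms, which only multiply by x and by constants, allow
    coefficients to be computed by rewriting. *)
Lemma discrM g : discr * g =
  g - x * (fpsC (1 + 'X) * g) *+ 2 + x * (x * (fpsC ((1 - 'X) ^+ 2) * g)).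
Proof. by rewrite /discr -fpsC_exp -oneB_fpsC -oneD_fpsC; ring. Qed.

Lemma half_discr_derivM g : half_discr_deriv * g =
  x * (fpsC ((1 - 'X) ^+ 2) * g) - fpsC (1 + 'X) * g.
Proof. by rewrite /half_discr_deriv -fpsC_exp -oneB_fpsC -oneD_fpsC; ring. Qed.

Lemma deriv_discr : fps_deriv discr = half_discr_deriv *+ 2.
Proof.
rewrite -[discr]mulr1 -[half_discr_deriv]mulr1 discrM half_discr_derivM.
apply: fps_ext => n; rewrite /fps_deriv !(fpsD, fpsN, fpsMn, fpsXM) /=.
by case: n => [|[|n]]; rewrite ?fpsXM /= !fpsCM !fps1 /=; ring.
Qed.

(** The degrees n >= 3 are the recurrence of the Narayana polynomials; the lower
    degrees involve the constant and linear terms of the square root, which are not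
    - 2 t times a Narayana polynomial. *)
Lemma sqrt_discr_ode : discr * fps_deriv sqrt_discr = half_discr_deriv * sqrt_discr.
Proof.
have w0 : sqrt_discr 0 = 1.
  by rewrite /sqrt_discr !fpsB fpsMn !fpsXM fps1 mul0rn !subr0.
have w1 : sqrt_discr 1 = - (1 + 'X).
  by rewrite /sqrt_discr oneB_fpsC !fpsB fpsMn !fpsXM fps1 /= fpsCM /c0 narayana0; ring.
have wE n : sqrt_discr n.+2 = - ('X * narayana n.+1) *+ 2.
  by rewrite /sqrt_discr oneB_fpsC !fpsB fpsMn !fpsXM fps1 /= fpsCM /c0; ring.
rewrite discrM half_discr_derivM; apply: fps_ext => n.
rewrite !(fpsD, fpsN, fpsMn, fpsXM); case: n => [|[|[|n]]] /=.
- by rewrite !fpsCM /fps_deriv w0 w1; ring.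
- by rewrite fpsXM /= !fpsCM /fps_deriv w0 w1 wE narayana1; ring.
- by rewrite fpsXM /= !fpsCM /fps_deriv w1 !wE narayana1 narayana2; ring.
rewrite fpsXM /= !fpsCM /fps_deriv !wE.
have := narayana_rec n; rewrite !scaler_nat => rec.
(* The recurrence gives n.+4 times C_(n+3) as a whole. *)
have -> : - ('X * narayana n.+3) *+ 2 *+ n.+4 = - ('X * (narayana n.+3 *+ n.+4)) *+ 2.
  by ring.
by rewrite rec; ring.
Qed.

Lemma sqrt_discr_sqr : sqrt_discr ^+ 2 = discr.
Proof.
apply/eqP; rewrite -subr_eq0; apply/eqP.
apply: (@fps_lin_ode_unique discr (half_discr_deriv *+ 2)).
- by rewrite -[discr]mulr1 discrM fpsD fpsB fpsMn !fpsXM fps1 mul0rn subr0 addr0.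
- rewrite fps_derivD fps_derivN expr2 fps_derivM deriv_discr.
  have ode := sqrt_discr_ode; ring: ode.
rewrite fpsB -[discr]mulr1 discrM fpsD fpsB fpsMn !fpsXM fps1 mul0rn subr0 addr0.
by rewrite expr2 fpsM big_ord1 /sqrt_discr !fpsB fpsMn !fpsXM fps1 mul0rn !subr0 mulr1 subrr.
Qed.

Lemma fpsX_mul_eq0 (f : fps {poly rat}) : x * f = 0 -> f = 0.
Proof.
move=> xf0; apply: fps_ext => n.
by have := congr1 (fun g : fps {poly rat} => g n.+1) xf0; rewrite /= fpsXM.
Qed.

(** Expanding w ^ 2 = Delta gives 4 t x times the quadratic equation of c0, and
    4, t and x can be cancelled. *)
Lemma narayana_functional : c0 = 1 + x * (c0 * c1).
Proof.
suff quad : 1 - c0 + x * (c0 * c1) = 0.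
  by rewrite -[LHS]addr0 -quad; ring.
apply: fpsX_mul_eq0; apply: fps_ext => n; rewrite fps0.
apply: (@poly_rat_mulrn_eq0 _ 3); apply: (@mulfI _ ('X : {poly rat})).
  by rewrite polyX_eq0.
(* The factor 4 is written 3.+1 above; together with t it completes the
   discriminant. *)
rewrite -fpsMn -fpsCM mulr0.
have -> : T * ((x * (1 - c0 + x * (c0 * c1))) *+ 4) = sqrt_discr ^+ 2 - discr.
  by rewrite c1E /sqrt_discr /discr; ring.
by rewrite sqrt_discr_sqr subrr.
Qed.

End Narayana.

(** * The reciprocal of c0 c1 *)
Section ConjugateRoot.

Local Notation T := (fpsC ('X : {poly rat})).
Local Notation x := (fpsX {poly rat}).

Definition cprod : fps {poly rat} := c0 * c1.

(** The other root of the quadratic equation of c0 c1, up to the factor t x^2;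
    hence the reciprocal. *)
Definition cprod_inv : fps {poly rat} := 1 - x * (1 + T) - x ^+ 2 * T * cprod.

Lemma cpow_double k : cpow (2 * k) = cprod ^+ k.
Proof.
elim: k => [|k IHk]; first by [].
have -> : (2 * k.+1 = (2 * k).+2)%N by rewrite mulnS.
have -> : cpow (2 * k).+2 = cpow (2 * k) * c0 * c1.
  by rewrite /= mul2n /= odd_double.
by rewrite IHk exprSr mulrA.
Qed.

Lemma cprod_mulV : cprod * cprod_inv = 1.
Proof.
have c0E : c0 = 1 + x * cprod by exact: narayana_functional.
have cprodE : cprod = (1 + x * cprod) * (1 + T * x * cprod).
  by rewrite {1}/cprod c1E c0E; ring.
have -> : cprod * cprod_inv = cprod - x * cprod * (1 + T) - x ^+ 2 * T * cprod ^+ 2.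
  by rewrite /cprod_inv; ring.
by rewrite {1}cprodE; ring.
Qed.

(** The reciprocal of c0 c1 and t x^2 c0 c1 have sum 1 - (1 + t) x and product
    t x^2, so their power sums satisfy a recurrence of order 2 that raises the
    degree in x by at most 1 per step. *)
Lemma cprod_pow_trace_coef k n : (k < n)%N ->
  (cprod_inv ^+ k + (x ^+ 2 * T * cprod) ^+ k) n = 0.
Proof.
have [m] := ubnP k; elim: m k n => // m IHm [|[|k]] n lt_km lt_kn.
- by rewrite !expr0 fpsD !fps1; case: n lt_kn => // n _; rewrite addr0.
- have -> : cprod_inv ^+ 1 + (x ^+ 2 * T * cprod) ^+ 1 = 1 - x * fpsC (1 + 'X).
    by rewrite /cprod_inv -oneD_fpsC; ring.
  by rewrite fpsB fpsXM fps1; case: n lt_kn => [|[|n]] //; rewrite subrr.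
set b := x ^+ 2 * T * cprod in IHm *.
have -> : cprod_inv ^+ k.+2 + b ^+ k.+2 =
    (cprod_inv ^+ k.+1 + b ^+ k.+1) - x * (fpsC (1 + 'X) * (cprod_inv ^+ k.+1 + b ^+ k.+1))
    - x * (x * (T * (cprod_inv ^+ k + b ^+ k))).
  have sumE : cprod_inv + b = 1 - x * fpsC (1 + 'X).
    by rewrite /cprod_inv -/b -oneD_fpsC; ring.
  have prodE : cprod_inv * b = x * (x * T) * (cprod * cprod_inv) by rewrite /b; ring.
  rewrite cprod_mulV mulr1 in prodE.
  have -> : cprod_inv ^+ k.+2 + b ^+ k.+2 = (cprod_inv + b) * (cprod_inv ^+ k.+1 + b ^+ k.+1)
     - cprod_inv * b * (cprod_inv ^+ k + b ^+ k) by rewrite !exprS; ring.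
  by rewrite sumE prodE mulrBl mul1r -!mulrA.
case: n lt_kn => [|[|n]] // lt_kn.
rewrite !fpsB !fpsXM !fpsCM !(IHm k.+1) ?(IHm k) ?mulr0 ?subrr //; lia.
Qed.

(** This is the source of the factor t ^ (k n), and of the equality up to a shift
    of the two families of Hankel determinants. *)
Lemma cprod_inv_pow_coef k n : (k < n)%N ->
  (cprod_inv ^+ k) n = - 'X^k * (x ^+ (2 * k) * cprod ^+ k) n.
Proof.
move=> lt_kn; apply/eqP; rewrite mulNr -addr_eq0 -fpsCM -fpsD.
rewrite -fpsC_exp mulrA [T ^+ k * _]mulrC exprM -!exprMn.
by rewrite cprod_pow_trace_coef.
Qed.

Lemma fps_exp0 (R : comNzRingType) (f : fps R) k : f 0%N = 1 -> (f ^+ k) 0%N = 1.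
Proof.
move=> f0; elim: k => [|k IHk] //.
by rewrite exprS fpsM big_ord1 f0 IHk mulr1.
Qed.

Lemma cprod0 : cprod 0%N = 1.
Proof. by rewrite /cprod fpsM big_ord1 mulr1. Qed.

Lemma cprod_inv0 : cprod_inv 0%N = 1.
Proof. by rewrite /cprod_inv !fpsB -[x ^+ 2 * T * cprod]mulrA fpsXnM fpsXM fps1 !subr0. Qed.

(** Coefficients of negative index are absorbed by a power of x. *)
Lemma Ccoef_shift K q n : Ccoef K (n%:Z - q%:Z) = (x ^+ q * cpow K) n.
Proof.
rewrite fpsXnM; case: ltnP => [lt_nq|le_qn]; last by rewrite subzn.
by have -> : n%:Z - q%:Z = Negz (q - n).-1 by rewrite NegzE; lia.
Qed.

End ConjugateRoot.

Theorem theorem3 (m k : nat) (hk : (0 < k)%N) :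
  (forall N : nat, (1 <= N <= m + k - 1)%N ->
     hankelD (2 * k)%N (1 - k%:Z - m%:Z) N = 0) /\
  (forall n : nat,
     hankelD (2 * k)%N (1 - k%:Z - m%:Z) (n + m + k)%N =
     (-1) ^+ 'C(m + k, 2) * 'X^(k * n) * hankelD (2 * k)%N (1 - k%:Z + m%:Z) n).
Proof.
have [q mkE] : exists q, (m + k = q.+1)%N by exists (m + k).-1; lia.
have lowE N : hankelD (2 * k) (1 - k%:Z - m%:Z) N =
    \det (\matrix_(i < N, j < N) (fpsX {poly rat} ^+ q * cprod ^+ k) (i + j)%N).
  congr (\det _); apply/matrixP => i j; rewrite !mxE -cpow_double -Ccoef_shift.
  by congr (Ccoef _ _); lia.
split=> [[|N] // /andP[_ leN]|n].
  rewrite lowE (expand_det_row _ ord0) big1 // => j _.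
  rewrite mxE fpsXnM ifT ?mul0r //=; have := ltn_ord j; lia.
have -> : (n + m + k = q.+1 + n)%N by lia.
rewrite lowE (@det_hankel_inv _ _ _ _ (cprod_inv ^+ k)); last 3 first.
- by rewrite -exprMn cprod_mulV expr1n.
- by rewrite fps_exp0 ?cprod0.
- by rewrite fps_exp0 ?cprod_inv0.
have -> : \matrix_(i < n, j < n) (cprod_inv ^+ k) (i + j + q.+2)%N =
    (- 'X^k) *: \matrix_(i < n, j < n) Ccoef (2 * k) (i%:Z + j%:Z + (1 - k%:Z + m%:Z)).
  apply/matrixP => i j; rewrite !mxE cprod_inv_pow_coef; last by lia.
  by rewrite -cpow_double -Ccoef_shift; congr (_ * Ccoef _ _); lia.
rewrite detZ -mkE mulrA -[_ * (-1) ^+ n * _]mulrA -exprMn mulN1r opprK.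
by rewrite exprM.
Qed.
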